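(* Let $f:\mathbb{R}^{m\times n}\to\mathbb{R}$ be $L$-smooth, i.e. $f({\bm X})\le f({\bm Y})+\langle\nabla f({\bm Y}),{\bm X}-{\bm Y}\rangle+\frac L2\|{\bm X}-{\bm Y}\|_F^2$ for all ${\bm X},{\bm Y}$, and let $f_*:=\inf_{{\bm X}} f({\bm X})>-\infty$. Fix $\tau>0$, $K\ge 1$, an initial point ${\bm X}_0$, and consider the iteration ${\bm X}_{k+1}={\bm X}_k-\eta\,\mathcal{C}_\tau({\bm G}_k)$ with constant step size $\eta=\frac{1}{4L\sqrt K}$, where the random matrices ${\bm G}_k$ satisfy $\mathbb{E}[{\bm G}_k\mid{\bm X}_k]=\nabla f({\bm X}_k)$ and $\mathbb{E}[\|{\bm G}_k-\nabla f({\bm X}_k)\|_F^\alpha\mid{\bm X}_k]\le\sigma^\alpha$ for some $\alpha\in(1,2]$ and $\sigma>0$. Then $$\min_{0\le k\le K-1}\mathbb{E}\big[\|\nabla f({\bm X}_k)\|_F^2\big]\le\frac{16L(f({\bm X}_0)-f_* )}{\sqrt K}+\frac{C_{\alpha,d}\,\tau^{2-\alpha}\sigma^\alpha}{8\sqrt K}+\frac2K\sum_{k=0}^{K-1}\Delta_k,$$ where $\Delta_k:=\mathbb{E}\big[\|\nabla f({\bm X}_k)-\mathbb{E}[\mathcal{C}_\tau({\bm G}_k)\mid{\bm X}_k]\|_F^2\big]$, $C_{\alpha,d}:=2^{4-\alpha}d^{1-\alpha/2}$ and $d=\min\{m,n\}$.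
   Context: $\|\cdot\|_F$ is the Frobenius norm and $\langle\cdot,\cdot\rangle$ the Frobenius inner product. Spectral clipping: for ${\bm G}\in\mathbb{R}^{m\times n}$ with (thin) SVD ${\bm G}={\bm U}\,\mathrm{diag}(\sigma_1,\dots,\sigma_d){\bm V}^\top$, $d=\min\{m,n\}$, and threshold $\tau>0$, define $\mathcal{C}_\tau({\bm G}):={\bm U}\,\mathrm{diag}(\min\{\sigma_1,\tau\},\dots,\min\{\sigma_d,\tau\}){\bm V}^\top$ (singular values exceeding $\tau$ are replaced by $\tau$, singular vectors unchanged). *)

(* Defs.v *)
From HB Require Import structures.
From mathcomp Require Import all_boot all_order all_algebra.
From mathcomp Require Import all_classical all_reals all_analysis.
Set Implicit Arguments. Unset Strict Implicit. Unset Printing Implicit Defensive.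
Import Order.TTheory GRing.Theory Num.Theory.
Local Open Scope classical_set_scope.
Local Open Scope ring_scope.

Section Matrices.
Variables (R : realType) (m n : nat).

Definition frob_inner (A B : 'M[R]_(m, n)) : R :=
  \sum_(i < m) \sum_(j < n) A i j * B i j.

Definition frob (A : 'M[R]_(m, n)) : R := Num.sqrt (frob_inner A A).

Definition is_thin_svd (G : 'M[R]_(m, n))
    (USV : 'M[R]_(m, minn m n) * 'rV[R]_(minn m n) * 'M[R]_(n, minn m n)) : Prop :=
  let: (U, s, V) := USV in
  [/\ U^T *m U = 1%:M, V^T *m V = 1%:M,
      (forall i, 0 <= s 0 i),
      (forall i j : 'I_(minn m n), (i <= j)%N -> s 0 j <= s 0 i) &
      G = U *m diag_mx s *m V^T].

(** Spectral clipping C_tau(G) = U diag(min(s_i, tau)) V^T for a thin SVD of G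
    (chosen by [xget]; the result is independent of the choice). *)
Definition spectral_clip (tau : R) (G : 'M[R]_(m, n)) : 'M[R]_(m, n) :=
  let: (U, s, V) := xget (0, 0, 0) (is_thin_svd G) in
  U *m diag_mx (\row_i Num.min (s 0 i) tau) *m V^T.

End Matrices.

Section CondExp.
Variables (d : measure_display) (T : measurableType d) (R : realType)
  (P : probability T R).

Definition sigma_of (m n : nat) (X : T -> 'M[R]_(m, n)) : set (set T) :=
  <<s [set A | exists (i : 'I_m) (j : 'I_n) (B : set R),
                 measurable B /\ A = (fun t => X t i j) @^-1` B] >>.

Definition F_measurable (F : set (set T)) (Y : T -> R) : Prop :=
  forall B : set R, measurable B -> F (Y @^-1` B).

Definition is_cond_exp (F : set (set T)) (Z Y : T -> R) : Prop :=
  [/\ F_measurable F Y,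
      P.-integrable setT (EFin \o Z),
      P.-integrable setT (EFin \o Y) &
      forall A, F A -> (\int[P]_(t in A) (Y t)%:E = \int[P]_(t in A) (Z t)%:E)%E].

Definition is_cond_exp_mx (m n : nat) (F : set (set T))
    (Z Y : T -> 'M[R]_(m, n)) : Prop :=
  forall i j, is_cond_exp F (fun t => Z t i j) (fun t => Y t i j).

Definition cond_exp_le (F : set (set T)) (Z : T -> R) (c : R) : Prop :=
  exists Y, is_cond_exp F Z Y /\ {ae P, forall t, Y t <= c}.

End CondExp.

(* Main.v *)
(** With g_k = grad f(X_k), C_k = C_tau(G_k), eta = 1 / (4 L sqrt K), smoothness
    gives pointwise
      f(X_(k+1)) - f(X_k) <= - eta <g_k, C_k> + (L eta^2 / 2) |C_k|^2.
    Conditioning on X_k replaces <g_k, C_k> by <g_k, H_k>, which polarization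
    turns into (|g_k|^2 + |H_k|^2 - |g_k - H_k|^2) / 2, and bounds E|C_k|^2 by
    E|H_k|^2 + E|C_k - C_tau(g_k)|^2.  Since L eta <= 1 the |H_k|^2 terms cancel
    favourably.  Clipping is the projection onto a spectral-norm ball, hence
    nonexpansive with increments at most 2 tau sqrt d, so that
    |C_k - C_tau(g_k)|^2 <= (2 tau sqrt d)^(2 - alpha) |G_k - g_k|^alpha.

    The conditional expectations are only ever tested against functions of g_k
    with finitely many values: g_k is bounded (|g|^2 <= 2 L (f - inf f) and the
    iterates stay in a ball), so it is rounded to a finite grid of mesh e, and
    e tends to 0 at the end. *)

Require Import Defs.
From HB Require Import structures.
From mathcomp Require Import all_boot all_order all_algebra.
From mathcomp Require Import all_classical all_reals all_analysis.
From mathcomp Require Import measurable_realfun ring lra.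
Import Order.TTheory GRing.Theory Num.Theory.
Import numFieldNormedType.Exports.
Local Open Scope classical_set_scope.
Local Open Scope ring_scope.

Set Implicit Arguments.
Unset Strict Implicit.

(** * Frobenius inner product and singular value decomposition *)

Section Frobenius.
Context {R : realType}.

Lemma frob_innerC m n (A B : 'M[R]_(m, n)) : frob_inner A B = frob_inner B A.
Proof. by apply: eq_bigr => i _; apply: eq_bigr => j _; rewrite mulrC. Qed.

Lemma frob_innerDl m n (A B C : 'M[R]_(m, n)) :
  frob_inner (A + B) C = frob_inner A C + frob_inner B C.
Proof.
rewrite /frob_inner -big_split; apply: eq_bigr => i _.
by rewrite -big_split; apply: eq_bigr => j _; rewrite mxE mulrDl.
Qed.

Lemma frob_innerZl m n a (A B : 'M[R]_(m, n)) :
  frob_inner (a *: A) B = a * frob_inner A B.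
Proof.
rewrite /frob_inner mulr_sumr; apply: eq_bigr => i _.
by rewrite mulr_sumr; apply: eq_bigr => j _; rewrite mxE mulrA.
Qed.

Lemma frob_innerNl m n (A B : 'M[R]_(m, n)) :
  frob_inner (- A) B = - frob_inner A B.
Proof. by rewrite -scaleN1r frob_innerZl mulN1r. Qed.

Lemma frob_innerBl m n (A B C : 'M[R]_(m, n)) :
  frob_inner (A - B) C = frob_inner A C - frob_inner B C.
Proof. by rewrite frob_innerDl frob_innerNl. Qed.

Lemma frob_innerDr m n (A B C : 'M[R]_(m, n)) :
  frob_inner A (B + C) = frob_inner A B + frob_inner A C.
Proof. by rewrite !(frob_innerC A) frob_innerDl. Qed.

Lemma frob_innerZr m n a (A B : 'M[R]_(m, n)) :
  frob_inner A (a *: B) = a * frob_inner A B.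
Proof. by rewrite !(frob_innerC A) frob_innerZl. Qed.

Lemma frob_innerNr m n (A B : 'M[R]_(m, n)) :
  frob_inner A (- B) = - frob_inner A B.
Proof. by rewrite !(frob_innerC A) frob_innerNl. Qed.

Lemma frob_innerBr m n (A B C : 'M[R]_(m, n)) :
  frob_inner A (B - C) = frob_inner A B - frob_inner A C.
Proof. by rewrite !(frob_innerC A) frob_innerBl. Qed.

Lemma frob_inner0l m n (A : 'M[R]_(m, n)) : frob_inner 0 A = 0.
Proof. by rewrite -(scale0r 0) frob_innerZl mul0r. Qed.

Definition frob_innerE :=
  (frob_innerDl, frob_innerDr, frob_innerBl, frob_innerBr, frob_innerNl,
   frob_innerNr, frob_innerZl, frob_innerZr).

Lemma frob_inner_tr m n (A B : 'M[R]_(m, n)) : frob_inner A B = \tr (A *m B^T).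
Proof.
apply: eq_bigr => i _; rewrite mxE.
by apply: eq_bigr => j _; rewrite mxE.
Qed.

Lemma frob_inner_mull m n p (A : 'M[R]_(m, p)) (B : 'M[R]_(p, n)) C :
  frob_inner (A *m B) C = frob_inner A (C *m B^T).
Proof. by rewrite !frob_inner_tr trmx_mul trmxK mulmxA. Qed.

Lemma frob_inner_mulr m n p (A : 'M[R]_(m, p)) (B : 'M[R]_(p, n)) C :
  frob_inner (A *m B) C = frob_inner B (A^T *m C).
Proof. by rewrite !frob_inner_tr trmx_mul trmxK -mulmxA mxtrace_mulC mulmxA. Qed.

Lemma frob_inner_ge0 m n (A : 'M[R]_(m, n)) : 0 <= frob_inner A A.
Proof. by do 2 (apply: sumr_ge0 => ? _); rewrite -expr2 sqr_ge0. Qed.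

Lemma frob_entry m n (A : 'M[R]_(m, n)) i j : A i j ^+ 2 <= frob_inner A A.
Proof.
rewrite /frob_inner (bigD1 i)//= (bigD1 j)//= -expr2 -addrA lerDl.
by rewrite addr_ge0// !sumr_ge0// => ? _; rewrite ?sumr_ge0// => *; rewrite -expr2 sqr_ge0.
Qed.

Lemma frob_inner_le0 m n (A : 'M[R]_(m, n)) : frob_inner A A <= 0 -> A = 0.
Proof.
move=> A0; apply/matrixP => i j; rewrite mxE; apply/eqP; rewrite -sqrf_eq0.
by rewrite eq_le sqr_ge0 andbT (le_trans (frob_entry A i j)).
Qed.

Lemma sqr_frob m n (A : 'M[R]_(m, n)) : frob A ^+ 2 = frob_inner A A.
Proof. by rewrite sqr_sqrtr ?frob_inner_ge0. Qed.

Lemma frob_ge0 m n (A : 'M[R]_(m, n)) : 0 <= frob A.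
Proof. exact: sqrtr_ge0. Qed.

Lemma frob_gt0 m n (A : 'M[R]_(m, n)) : A != 0 -> 0 < frob A.
Proof.
move=> A0; rewrite lt_neqAle frob_ge0 andbT eq_sym.
apply: contra A0 => /eqP fA; apply/eqP/frob_inner_le0.
by rewrite -sqr_frob fA expr0n.
Qed.

Lemma frob_inner_young m n (A B : 'M[R]_(m, n)) :
  2 * frob_inner A B <= frob_inner A A + frob_inner B B.
Proof.
have := frob_inner_ge0 (A - B); rewrite !frob_innerE (frob_innerC B A); lra.
Qed.

Lemma frob_innerD_le m n (A B : 'M[R]_(m, n)) :
  frob_inner (A + B) (A + B) <= 2 * (frob_inner A A + frob_inner B B).
Proof.
have := frob_inner_young A B; rewrite !frob_innerE (frob_innerC B A); lra.
Qed.

End Frobenius.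

(** * Existence of a thin singular value decomposition *)

Section SVD.
Context {R : realType}.

Lemma continuous_coord_sum (T : topologicalType) (I : Type) (r : seq I)
    (F : I -> T -> R) : (forall i, continuous (F i)) ->
  continuous (fun x => \sum_(i <- r) F i x).
Proof.
move=> cF; elim: r => [|i r IH] x.
  by under eq_fun do rewrite big_nil; exact: cvg_cst.
under eq_fun do rewrite big_cons.
by apply: continuousD; [exact: cF|exact: IH].
Qed.

Lemma frob_inner_mulmx_continuous p q (M N : 'M[R]_(p, q)) :
  continuous (fun w : 'rV[R]_p => frob_inner (w *m M) (w *m N)).
Proof.
have cont (B : 'M[R]_(p, q)) i j : continuous (fun w : 'rV[R]_p => (w *m B) i j).
  move=> w; under eq_fun do rewrite mxE.
  apply: continuous_coord_sum => k {}w.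
  apply: continuousM; first exact: coord_continuous.
  exact: cst_continuous.
move=> w; apply: continuous_coord_sum => i {}w.
by apply: continuous_coord_sum => j {}w; apply: continuousM; exact: cont.
Qed.

Lemma unit_kernel_vector p q (A : 'M[R]_(p, q)) : (q < p)%N ->
  exists2 u : 'rV[R]_p, u *m A = 0 & frob_inner u u = 1.
Proof.
move=> qp; have : kermx A != 0.
  by rewrite -mxrank_eq0 mxrank_ker subn_eq0 -ltnNge (leq_ltn_trans (rank_leq_col A)).
move=> /rowV0Pn[u /sub_kermxP uA u0]; exists ((frob u)^-1 *: u).
  by rewrite -scalemxAl uA scaler0.
by rewrite !frob_innerE -sqr_frob; field; rewrite gt_eqF// frob_gt0.
Qed.

(** A continuous bilinear form attains its maximum on the compact set of pairs of unit vectors. The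
    columns of [A] and [B] will be the singular vectors already found, so the kernel conditions
    express orthogonality to them. *)
Lemma exists_top_singular_pair m n p q (G : 'M[R]_(m, n)) (A : 'M[R]_(m, p))
    (B : 'M[R]_(n, q)) : (p < m)%N -> (q < n)%N ->
  exists u : 'rV[R]_m, exists v : 'rV[R]_n,
  [/\ u *m A = 0, v *m B = 0, frob_inner u u = 1, frob_inner v v = 1 &
   forall (u' : 'rV[R]_m) (v' : 'rV[R]_n), u' *m A = 0 -> v' *m B = 0 ->
     frob_inner (u' *m G) v' <= frob_inner (u *m G) v * (frob u' * frob v')].
Proof.
move=> pm qn.
(* The pair [(u, v)] is encoded as one row vector [w] of length [m + n], with [l] and [r] extracting
   its halves, so that compactness and the extreme value theorem for row vectors apply. *)
pose l : 'M[R]_(m + n, m) := col_mx 1%:M 0.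
pose r : 'M[R]_(m + n, n) := col_mx 0 1%:M.
have lE u v : row_mx u v *m l = u by rewrite mul_row_col mulmx1 mulmx0 addr0.
have rE u v : row_mx u v *m r = v by rewrite mul_row_col mulmx1 mulmx0 add0r.
have lrE (w : 'rV[R]_(m + n)) : w = row_mx (w *m l) (w *m r).
  by rewrite -mul_mx_row -block_mxEh -scalar_mx_block mulmx1.
(* Each constraint, including membership in a kernel, is written as a level set of a quadratic form
   [|w M|^2]; closedness then comes from [cQ] alone. *)
pose S := [set w : 'rV[R]_(m + n) |
  [/\ frob_inner (w *m (l *m A)) (w *m (l *m A)) = 0,
      frob_inner (w *m (r *m B)) (w *m (r *m B)) = 0,
      frob_inner (w *m l) (w *m l) = 1 & frob_inner (w *m r) (w *m r) = 1]].
have cQ q' (M : 'M[R]_(m + n, q')) c :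
    closed [set w : 'rV[R]_(m + n) | frob_inner (w *m M) (w *m M) = c].
  apply: (@preimage_closed _ _ (fun w : 'rV[R]_(m + n) =>
    frob_inner (w *m M) (w *m M)) [set c]); last exact: closed_eq.
  by move=> w _; exact: frob_inner_mulmx_continuous.
have cS : closed S.
  rewrite (_ : S = [set w | frob_inner (w *m (l *m A)) (w *m (l *m A)) = 0] `&`
    [set w | frob_inner (w *m (r *m B)) (w *m (r *m B)) = 0] `&`
    [set w | frob_inner (w *m l) (w *m l) = 1] `&`
    [set w | frob_inner (w *m r) (w *m r) = 1]).
    by do 3 (apply: closedI; last exact: cQ); exact: cQ.
  by apply/seteqP; split=> w /=; [case|move=> [[[]]]].
have kS : compact S.
  have kc := @rV_compact R (m + n) (fun=> `[-1, 1]%classic)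
    (fun=> @segment_compact R (-1) 1).
  apply: (subclosed_compact cS kc) => w [_ _ l1 r1] i.
  suff : `|w ord0 i| <= 1 by rewrite ler_norml /= in_itv.
  rewrite -(@ler_pXn2r _ 2%N)// ?nnegrE// expr1n real_normK ?num_real//.
  rewrite (lrE w) mxE; case: splitP => j _.
    by rewrite -l1 frob_entry.
  by rewrite -r1 frob_entry.
have [u0 u0A u01] := unit_kernel_vector A pm.
have [v0 v0B v01] := unit_kernel_vector B qn.
have S0 : S !=set0.
  exists (row_mx u0 v0); rewrite /S /= !mulmxA !lE !rE u0A v0B.
  by rewrite !frob_inner0l.
have [] := @EVT_max_rV R _ (fun w => frob_inner (w *m (l *m G)) (w *m r)) S S0 kS.
  by apply: continuous_subspaceT; exact: frob_inner_mulmx_continuous.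
move=> w; rewrite inE (lrE w) /S /= !mulmxA !lE !rE => -[uA vB u1 v1 wmax].
exists (w *m l), (w *m r); split => //.
- by apply: frob_inner_le0; rewrite uA.
- by apply: frob_inner_le0; rewrite vB.
move=> u' v' u'A v'B.
have [->|u'0] := eqVneq u' 0; first
  by rewrite mul0mx frob_inner0l /frob frob_inner0l sqrtr0 mul0r mulr0.
have [->|v'0] := eqVneq v' 0; first
  by rewrite frob_innerC frob_inner0l /frob frob_inner0l sqrtr0 !mulr0.
have fu := frob_gt0 u'0; have fv := frob_gt0 v'0.
have /wmax : row_mx ((frob u')^-1 *: u') ((frob v')^-1 *: v') \in S.
  rewrite inE /S /= !mulmxA !lE !rE -!scalemxAl u'A v'B !scaler0 !frob_inner0l.
  by rewrite !frob_innerE -!sqr_frob; split=> //; field; rewrite gt_eqF.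
rewrite !mulmxA !lE !rE -!scalemxAl !frob_innerE mulrA -invfM mulrC ler_pdivrMr ?mulr_gt0//.
Qed.

(** Greedy induction: each new pair maximizes the bilinear form of [G] on the orthogonal complement
    of the earlier ones. The last clause records this extremality, which at the next stage makes the
    singular values nonincreasing. *)
Lemma partial_svd m n (G : 'M[R]_(m, n)) k : (k <= minn m n)%N ->
  exists (u : nat -> 'rV[R]_m) (v : nat -> 'rV[R]_n) (s : nat -> R),
  [/\ forall i j, (i < k)%N -> (j < k)%N ->
        frob_inner (u i) (u j) = (i == j)%:R /\
        frob_inner (v i) (v j) = (i == j)%:R,
      forall i, (i < k)%N -> 0 <= s i,
      forall i j, (i <= j < k)%N -> s j <= s i,
      forall i, (i < k)%N -> u i *m G = s i *: v i /\ v i *m G^T = s i *: u i &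
      forall i (u' : 'rV[R]_m) (v' : 'rV[R]_n), (i < k)%N ->
        (forall j, (j < k)%N -> frob_inner u' (u j) = 0) ->
        (forall j, (j < k)%N -> frob_inner v' (v j) = 0) ->
        frob_inner (u' *m G) v' <= s i * (frob u' * frob v')].
Proof.
elim: k => [_|k IH kmn]; first by exists (fun=> 0), (fun=> 0), (fun=> 0).
have [km kn] : (k < m)%N /\ (k < n)%N by move: kmn; rewrite leq_min => /andP[].
have [u [v [s [uvO s0 s_decr uvG top]]]] := IH (ltnW kmn).
pose A := \matrix_(i < m, j < k) u j 0 i.
pose B := \matrix_(i < n, j < k) v j 0 i.
have orthE p (w : nat -> 'rV[R]_p) (x : 'rV[R]_p) :
    x *m (\matrix_(i < p, j < k) w j 0 i) = 0 <->
    forall j, (j < k)%N -> frob_inner x (w j) = 0.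
  split=> [xA j jk|xw].
    have /rowP/(_ (Ordinal jk)) := xA; rewrite !mxE; apply: etrans.
    by rewrite /frob_inner big_ord1; apply: eq_bigr => i _; rewrite mxE.
  apply/rowP => j; rewrite !mxE; apply: etrans (xw j _) => //.
  by rewrite /frob_inner big_ord1; apply: eq_bigr => i _; rewrite mxE.
have [uk [vk [ukA vkB uk1 vk1 uvmax]]] := exists_top_singular_pair G A B km kn.
set sk := frob_inner (uk *m G) vk in uvmax.
have frob1 p (x : 'rV[R]_p) : frob_inner x x = 1 -> frob x = 1.
  by move=> x1; rewrite /frob x1 sqrtr1.
have uku j : (j < k)%N -> frob_inner uk (u j) = 0 by move: j; exact/orthE.
have vkv j : (j < k)%N -> frob_inner vk (v j) = 0 by move: j; exact/orthE.
(* Replacing [uk] by [- uk] gives a competitor with value [- sk]. *)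
have sk0 : 0 <= sk.
  have := uvmax (- uk) vk; rewrite mulNmx ukA oppr0 => /(_ erefl vkB).
  by rewrite mulNmx /frob !frob_innerE opprK uk1 vk1 sqrtr1 mulr1 -/sk; lra.
(* The image of [uk] stays orthogonal to the earlier singular vectors, so the
   extremal inequality applies to it; this forces [|uk G| <= sk], hence
   [|uk G - sk vk|^2 <= sk^2 - 2 sk^2 + sk^2 = 0]. *)
have ukG : uk *m G = sk *: vk.
  have ukGB : uk *m G *m B = 0.
    apply/orthE => j jk; rewrite frob_inner_mull.
    by have [_ ->] := uvG j jk; rewrite frob_innerZr uku// mulr0.
  have := uvmax uk (uk *m G) ukA ukGB; rewrite -sqr_frob (frob1 _ uk)// mul1r expr2.
  have := frob_ge0 (uk *m G); rewrite le_eqVlt => /predU1P[G0 _|G0]; last first.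
    rewrite ler_pM2r// => Gsk; apply/subr0_eq/frob_inner_le0.
    rewrite !frob_innerE vk1 (frob_innerC vk) -/sk -sqr_frob.
    have : frob (uk *m G) ^+ 2 <= sk ^+ 2 by rewrite ler_sqr ?nnegrE// ltW.
    lra.
  have uG0 : uk *m G = 0 by apply: frob_inner_le0; rewrite -sqr_frob -G0 expr0n.
  by rewrite /sk uG0 frob_inner0l scale0r.
have skE : sk = frob_inner (vk *m G^T) uk.
  by rewrite frob_inner_mull trmxK frob_innerC.
have vkG : vk *m G^T = sk *: uk.
  have vkGA : vk *m G^T *m A = 0.
    apply/orthE => j jk; rewrite frob_inner_mull trmxK.
    by have [-> _] := uvG j jk; rewrite frob_innerZr vkv// mulr0.
  have := uvmax (vk *m G^T) vk vkGA vkB.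
  rewrite frob_inner_mull -sqr_frob (frob1 _ vk)// mulr1 expr2.
  have := frob_ge0 (vk *m G^T); rewrite le_eqVlt => /predU1P[G0 _|G0]; last first.
    rewrite ler_pM2r// => Gsk; apply/subr0_eq/frob_inner_le0.
    rewrite !frob_innerE uk1 (frob_innerC uk) -skE -sqr_frob.
    have : frob (vk *m G^T) ^+ 2 <= sk ^+ 2 by rewrite ler_sqr ?nnegrE// ltW.
    lra.
  have vG0 : vk *m G^T = 0 by apply: frob_inner_le0; rewrite -sqr_frob -G0 expr0n.
  by rewrite skE vG0 frob_inner0l scale0r.
(* The new pair is orthogonal to all earlier vectors, hence was already admissible in the
   extremality clause of each earlier index. *)
have s_ge j : (j < k)%N -> sk <= s j.
  move=> jk; have := top j uk vk jk uku vkv.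
  by rewrite (frob1 _ uk)// (frob1 _ vk)// !mulr1.
pose ext S (w : nat -> S) x i := if (i < k)%N then w i else x.
exists (ext _ u uk), (ext _ v vk), (ext _ s sk); rewrite /ext; split.
- move=> i j; rewrite !ltnS (leq_eqVlt i) (leq_eqVlt j) => /predU1P[->|ik] /predU1P[->|jk].
  + by rewrite ltnn eqxx.
  + by rewrite ltnn jk gtn_eqF// uku// vkv.
  + by rewrite ltnn ik ltn_eqF// frob_innerC uku// frob_innerC vkv.
  + by rewrite ik jk; exact: uvO.
- by move=> i _; case: ifP => // /s0.
- move=> i j /andP[ij _]; case: ifPn => jk.
    by rewrite (leq_ltn_trans ij jk) s_decr// ij.
  by case: ifPn => // /s_ge.
- by move=> i _; case: ifP => // /uvG.
move=> i u' v' ik u'u v'v.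
have lt j : (j < k)%N -> (j < k.+1)%N by exact: ltnW.
have le_sk : frob_inner (u' *m G) v' <= sk * (frob u' * frob v').
  apply: uvmax; apply/orthE => j jk.
    by have := u'u j (lt _ jk); rewrite jk.
  by have := v'v j (lt _ jk); rewrite jk.
apply: le_trans le_sk _; case: ifP => // /s_ge sks.
by rewrite ler_wpM2r// mulr_ge0 ?frob_ge0.
Qed.

Lemma thin_svd_exists m n (G : 'M[R]_(m, n)) : exists USV, is_thin_svd G USV.
Proof.
have [u [v [s [uvO s0 s_decr uvG _]]]] := @partial_svd m n G (minn m n) (leqnn _).
pose U := \matrix_(i < m, j < minn m n) u j 0 i.
pose V := \matrix_(i < n, j < minn m n) v j 0 i.
pose S := \row_(j < minn m n) s j.
have UU : U^T *m U = 1%:M.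
  apply/matrixP => i j; rewrite !mxE.
  have [<- _] := uvO i j (ltn_ord i) (ltn_ord j); rewrite /frob_inner big_ord1.
  by apply: eq_bigr => l _; rewrite !mxE.
have VV : V^T *m V = 1%:M.
  apply/matrixP => i j; rewrite !mxE.
  have [_ <-] := uvO i j (ltn_ord i) (ltn_ord j); rewrite /frob_inner big_ord1.
  by apply: eq_bigr => l _; rewrite !mxE.
have UG : U^T *m G = diag_mx S *m V^T.
  apply/matrixP => i j; rewrite mul_diag_mx !mxE.
  have [/rowP/(_ j) + _] := uvG i (ltn_ord i); rewrite !mxE => <-.
  by apply: eq_bigr => l _; rewrite !mxE.
have GV : G *m V = U *m diag_mx S.
  apply/matrixP => i j; rewrite mul_mx_diag !mxE.
  have [_ /rowP/(_ i)] := uvG j (ltn_ord j); rewrite !mxE mulrC => <-.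
  by apply: eq_bigr => l _; rewrite !mxE mulrC.
exists (U, S, V); split=> //.
- by move=> i; rewrite mxE s0.
- by move=> i j ij; rewrite !mxE s_decr// ij ltn_ord.
have right_inv p q (W : 'M[R]_(p, q)) : p = q -> W^T *m W = 1%:M -> W *m W^T = 1%:M.
  by move=> pq; move: W; rewrite pq => W /mulmx1C.
have [mn|nm] := orP (leq_total m n).
  have UUT : U *m U^T = 1%:M by apply: right_inv; rewrite ?(minn_idPl mn).
  by rewrite -mulmxA -UG mulmxA UUT mul1mx.
have VVT : V *m V^T = 1%:M by apply: right_inv; rewrite ?(minn_idPr nm).
by rewrite -GV -mulmxA VVT mulmx1.
Qed.

End SVD.

(** * Spectral clipping: projection property and moduli of continuity *)

Section Clipping.
Context {R : realType}.

Lemma frob_inner_svd_diag m n p q (U : 'M[R]_(m, p)) (V : 'M[R]_(n, p))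
    (U' : 'M[R]_(m, q)) (V' : 'M[R]_(n, q)) (a : 'rV[R]_p) (b : 'rV[R]_q) :
  frob_inner (U *m diag_mx a *m V^T) (U' *m diag_mx b *m V'^T) =
  \sum_i a 0 i * \sum_j b 0 j * ((U^T *m U') i j * (V^T *m V') i j).
Proof.
rewrite -mulmxA frob_inner_mulr frob_inner_mull trmxK !mulmxA -[_ *m _ *m V]mulmxA.
rewrite -[V'^T *m V]trmxK trmx_mul trmxK /frob_inner.
transitivity (\sum_(i < p) a 0 i * (U^T *m U' *m diag_mx b *m (V^T *m V')^T) i i).
  apply: eq_bigr => i _; rewrite (bigD1 i)//= big1 ?addr0.
    by rewrite mxE eqxx mulr1n.
  by move=> j ji; rewrite mxE eq_sym (negPf ji) mulr0n mul0r.
apply: eq_bigr => i _; congr (_ * _); rewrite mxE; apply: eq_bigr => j _.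
by rewrite mul_mx_diag mxE [(V^T *m V')^T j i]mxE; ring.
Qed.

(** Expand the squared norm of the residual [u - W W^T u], which is nonnegative. *)
Lemma bessel p q (W : 'M[R]_(p, q)) (u : 'cV[R]_p) : W^T *m W = 1%:M ->
  frob_inner (W^T *m u) (W^T *m u) <= frob_inner u u.
Proof.
move=> WW; have := frob_inner_ge0 (u - W *m (W^T *m u)).
rewrite !frob_innerE frob_inner_mulr (frob_inner_mulr W) !mulmxA WW mul1mx.
rewrite [frob_inner u (W *m _ *m _)]frob_innerC -mulmxA frob_inner_mulr; lra.
Qed.

Lemma orthonormal_row_le1 p q r (W : 'M[R]_(p, q)) (W' : 'M[R]_(p, r)) i :
  W^T *m W = 1%:M -> W'^T *m W' = 1%:M ->
  \sum_j (W^T *m W') i j ^+ 2 <= 1.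
Proof.
move=> WW WW'; have := bessel (col i W) WW'; rewrite /frob_inner.
have -> : \sum_k \sum_j col i W k j * col i W k j = 1.
  transitivity ((W^T *m W) i i); last by rewrite WW mxE eqxx.
  by rewrite mxE; apply: eq_bigr => k _; rewrite big_ord1 !mxE.
apply: le_trans; rewrite le_eqVlt; apply/orP; left; apply/eqP.
apply: eq_bigr => j _; rewrite big_ord1 -expr2; congr (_ ^+ 2); rewrite !mxE.
by apply: eq_bigr => k _; rewrite !mxE mulrC.
Qed.

(** Existence of a thin SVD rules out the default value of [xget]. Everything later uses only that
    some thin SVD was chosen. *)
Lemma spectral_clip_svd m n (tau : R) (G : 'M[R]_(m, n)) : exists U s V,
  is_thin_svd G (U, s, V) /\
  spectral_clip tau G = U *m diag_mx (\row_i Num.min (s 0 i) tau) *m V^T.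
Proof.
rewrite /spectral_clip; have [USV GUSV] := thin_svd_exists G.
by case: xgetP => [[[U s] V] _ ?|/(_ USV)//]; exists U, s, V.
Qed.

Lemma sqr_frob_spectral_clip_le m n (tau : R) (G : 'M[R]_(m, n)) : 0 <= tau ->
  frob_inner (spectral_clip tau G) (spectral_clip tau G) <= (minn m n)%:R * tau ^+ 2.
Proof.
move=> tau0; have [U [s [V [[UU VV s0 _ _] ->]]]] := spectral_clip_svd tau G.
rewrite frob_inner_svd_diag UU VV.
apply: (@le_trans _ _ (\sum_(i < minn m n) tau ^+ 2)); last first.
  by rewrite sumr_const card_ord mulr_natl.
apply: ler_sum => i _; rewrite (bigD1 i)//= big1 ?addr0; last first.
  by move=> j ji; rewrite [X in _ * X]mulrC !mxE eq_sym (negPf ji) mulr0n !mulr0.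
rewrite !mxE eqxx mulr1n !mulr1 -expr2 ler_sqr ?nnegrE ?ge_min ?lexx ?orbT//.
by rewrite le_min s0.
Qed.

(* First-order optimality: clipping is the metric projection onto the spectral
   norm ball of radius [tau]. *)
Lemma spectral_clip_obtuse m n (tau : R) (G G' : 'M[R]_(m, n)) : 0 <= tau ->
  frob_inner (G - spectral_clip tau G) (spectral_clip tau G' - spectral_clip tau G)
    <= 0.
Proof.
move=> tau0.
have [U [s [V [[UU VV s0 _ GE] ->]]]] := spectral_clip_svd tau G.
have [U' [s' [V' [[UU' VV' s'0 _ _] ->]]]] := spectral_clip_svd tau G'.
rewrite [X in X - _]GE -mulmxBl -mulmxBr -linearB /=.
set a := s - _; have a0 i : 0 <= a 0 i by rewrite !mxE subr_ge0 ge_min lexx.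
rewrite frob_innerBr subr_le0 !frob_inner_svd_diag.
(* With [a] the excess of the singular values over [tau], the sum of [a i * tau] separates the two
   products: it bounds the one with the clipping of [G'] from above and is at most the one with the
   clipping of [G]. *)
apply: (@le_trans _ _ (\sum_i a 0 i * tau)).
  apply: ler_sum => i _; rewrite ler_wpM2l//.
  have := orthonormal_row_le1 i UU UU'; have := orthonormal_row_le1 i VV VV'.
  set x := \sum_j _; set y := \sum_j _ => x1 y1.
  apply: (@le_trans _ _ (tau / 2 * (x + y))); last first.
    have : tau * (x + y) <= tau * 2 by rewrite ler_wpM2l//; lra.
    by lra.
  rewrite /x /y -big_split mulr_sumr; apply: ler_sum => j _ /=; rewrite mxE.
  set M := (U^T *m U') i j; set N := (V^T *m V') i j.
  have c0 : 0 <= Num.min (s' 0 j) tau by rewrite le_min s'0.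
  have c1 : Num.min (s' 0 j) tau <= tau by rewrite ge_min lexx orbT.
  have MN : M * N <= (N ^+ 2 + M ^+ 2) / 2 by have := sqr_ge0 (M - N); lra.
  apply: le_trans (ler_wpM2l c0 MN) _.
  have X0 : 0 <= (N ^+ 2 + M ^+ 2) / 2 by rewrite divr_ge0// addr_ge0 ?sqr_ge0.
  by apply: le_trans (ler_wpM2r X0 c1) _; rewrite mulrA mulrAC.
apply: ler_sum => i _; rewrite UU VV (bigD1 i)//= big1 ?addr0; last first.
  by move=> j ji; rewrite [X in _ * X]mulrC !mxE eq_sym (negPf ji) mulr0n !mulr0.
rewrite !mxE eqxx mulr1n !mulr1.
(* Either the excess vanishes, or the clipped value is exactly [tau]. *)
by case: (leP (s 0 i) tau) => _; rewrite ?subrr ?mul0r.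
Qed.

(** Adding the obtuse-angle inequalities at [G] and [G'] gives [|C - C'|^2 <= <G - G', C - C'>], and
    Young's inequality concludes. *)
Lemma spectral_clip_nonexpansive m n (tau : R) (G G' : 'M[R]_(m, n)) : 0 <= tau ->
  frob_inner (spectral_clip tau G - spectral_clip tau G')
    (spectral_clip tau G - spectral_clip tau G') <= frob_inner (G - G') (G - G').
Proof.
move=> tau0.
have := spectral_clip_obtuse G G' tau0; have := spectral_clip_obtuse G' G tau0.
set C := spectral_clip tau G; set C' := spectral_clip tau G'.
have := frob_inner_young (G - G') (C - C').
rewrite !frob_innerE (frob_innerC G' G) (frob_innerC C' C); lra.
Qed.

Lemma powR_half (x a : R) : 0 <= x -> x `^ (a / 2) = Num.sqrt x `^ a.
Proof. by move=> x0; rewrite mulrC powRrM powR12_sqrt. Qed.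

(** Interpolation: write [|D|^2] as [|D|^(2 - alpha) |D|^alpha], bound the first factor by the
    diameter [2 tau sqrt d] of the clipped range and the second by nonexpansiveness. *)
Lemma sqr_frob_spectral_clipB_le m n (tau alpha : R) (G G' : 'M[R]_(m, n)) :
  0 < tau -> 0 < alpha <= 2 ->
  frob_inner (spectral_clip tau G - spectral_clip tau G')
    (spectral_clip tau G - spectral_clip tau G') <=
  2 `^ (2 - alpha) * (minn m n)%:R `^ (1 - alpha / 2)
    * tau `^ (2 - alpha) * frob (G - G') `^ alpha.
Proof.
move=> tau0 /andP[alpha0 alpha2]; set D := spectral_clip tau G - _.
have D1 : frob D <= frob (G - G').
  by rewrite ler_wsqrtr// spectral_clip_nonexpansive// ltW.
have D2 : frob D <= 2 * Num.sqrt (minn m n)%:R * tau.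
  rewrite -ler_sqr ?nnegrE ?frob_ge0 ?mulr_ge0 ?sqrtr_ge0 ?(ltW tau0)// sqr_frob.
  rewrite !exprMn sqr_sqrtr// -mulrA.
  have := sqr_frob_spectral_clip_le G (ltW tau0).
  have := sqr_frob_spectral_clip_le G' (ltW tau0).
  have := frob_innerD_le (spectral_clip tau G) (- spectral_clip tau G').
  rewrite -/D frob_innerNl frob_innerNr opprK.
  by set b := _%:R * tau ^+ 2; lra.
have DE : frob_inner D D = frob D `^ (2 - alpha) * frob D `^ alpha.
  have [D0|D0] := eqVneq (frob D) 0.
    by rewrite -sqr_frob D0 [0 `^ alpha]powR0 ?gt_eqF// mulr0 expr0n.
  by rewrite -powRD ?D0 ?implybT// subrK -sqr_frob powR_mulrn// frob_ge0.
have dE : (minn m n)%:R `^ (1 - alpha / 2) = Num.sqrt (minn m n)%:R `^ (2 - alpha).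
  by rewrite -powR_half//; congr (_ `^ _); field.
rewrite DE dE.
have <- : (2 * Num.sqrt (minn m n)%:R * tau) `^ (2 - alpha) =
    2 `^ (2 - alpha) * Num.sqrt (minn m n)%:R `^ (2 - alpha) * tau `^ (2 - alpha).
  by rewrite !powRM ?mulr_ge0 ?sqrtr_ge0 ?(ltW tau0).
have nneg2 : 0 <= 2 * Num.sqrt (minn m n)%:R * tau.
  by rewrite !mulr_ge0 ?sqrtr_ge0 ?(ltW tau0).
by rewrite ler_pM ?powR_ge0// ge0_ler_powR ?nnegrE ?frob_ge0 ?subr_ge0 ?(ltW alpha0).
Qed.

End Clipping.

(** * Finite quantization and conditional expectation *)

Lemma forall_g_sigma_algebra d (T : measurableType d) (F : set (set T)) (J : finType)
    (A : J -> set T) : (forall i, <<s F >> (A i)) ->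
  <<s F >> [set t | forall i, A i t].
Proof.
move=> FA; have -> : [set t | forall i, A i t] = \bigcap_(i in setT) A i.
  by apply/seteqP; split=> t At ij; [move=> _; exact: (At ij)|exact: (At ij I)].
apply: (@fin_bigcap_measurable _ (g_sigma_algebraType F)) => [|i _]; last exact: FA.
by [].
Qed.

Section FiniteQuantization.
Context d (T : measurableType d) (R : realType).

(** Each entry is rounded down to a grid. Boundedness of [g] leaves finitely many grid points, and
    each cell is a finite intersection of preimages of half-open intervals, so it lies in the
    sigma-algebra. *)
Lemma entry_quantization m n (g : T -> 'M[R]_(m, n)) (F : set (set T)) M e :
  (forall t, frob_inner (g t) (g t) <= M) -> 0 < e ->
  (forall i j, F_measurable <<s F >> (fun t => g t i j)) ->
  (forall i j, measurable_fun setT (fun t => g t i j)) ->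
  exists (S : finType) (q : T -> S) (psi : S -> 'M[R]_(m, n)),
    (forall s, <<s F >> (q @^-1` [set s]) /\ measurable (q @^-1` [set s])) /\
    forall t, frob_inner (g t - psi (q t)) (g t - psi (q t)) <= e ^+ 2.
Proof.
move=> gM e0 gF mg.
have M0 : 0 <= M by apply: le_trans (frob_inner_ge0 (g point)) (gM _).
(* A bound on the entries without a square root: [x^2 <= M] implies [2 |x| <= 1 + M]. *)
pose a := 1 + M.
have ga t i j : - a <= g t i j <= a.
  have : g t i j ^+ 2 <= M := le_trans (frob_entry _ _ _) (gM t).
  rewrite /a => h; have h1 := sqr_ge0 (g t i j - 1); have h2 := sqr_ge0 (g t i j + 1).
  by apply/andP; split; nra.
(* The mesh makes [m n h^2 <= e^2]; the added 1 keeps the denominator positive when the matrix is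
   empty. *)
pose h := e / (1 + (m * n)%:R).
have h0 : 0 < h by rewrite divr_gt0// addrC ltr_wpDl.
pose lvl t i j := Num.trunc ((g t i j + a) / h).
pose B := Num.trunc (2 * a / h).
have arg_ge0 t i j : 0 <= (g t i j + a) / h.
  by rewrite divr_ge0 ?(ltW h0)//; have /andP[+ _] := ga t i j; lra.
have lvlB t i j : (lvl t i j < B.+1)%N.
  rewrite ltnS; apply: le_truncn; rewrite ler_pM2r ?invr_gt0//.
  by have /andP[_] := ga t i j; lra.
pose q t : 'M['I_B.+1]_(m, n) := \matrix_(i, j) inord (lvl t i j).
pose psi (Q : 'M['I_B.+1]_(m, n)) : 'M[R]_(m, n) :=
  \matrix_(i, j) (h * (Q i j : nat)%:R - a).
have qE (Q : 'M['I_B.+1]_(m, n)) : q @^-1` [set Q] =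
    [set t | forall ij : 'I_m * 'I_n, ((fun t => g t ij.1 ij.2) @^-1`
      [set` `[h * (Q ij.1 ij.2 : nat)%:R - a, h * (Q ij.1 ij.2 : nat).+1%:R - a[]) t].
  have lvlE t i j : lvl t i j = Q i j <->
      g t i j \in `[h * (Q i j : nat)%:R - a, h * (Q i j : nat).+1%:R - a[.
    rewrite in_itv /= lerBlDr ltrBrDr -ler_pdivlMl// -ltr_pdivrMl// mulrC.
    by rewrite -truncn_eq//; split=> /eqP.
  apply/seteqP; split=> t /= qQ.
    move=> [i j] /=; apply/lvlE.
    by have /matrixP/(_ i j) := qQ; rewrite mxE => <-; rewrite inordK.
  apply/matrixP => i j; rewrite mxE; apply: val_inj; rewrite /= inordK//.
  exact/lvlE/(qQ (i, j)).
exists 'M['I_B.+1]_(m, n), q, psi; split.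
  move=> Q; rewrite qE; split.
    by apply: forall_g_sigma_algebra => -[i j]; apply: gF.
  rewrite (_ : mkset _ = \bigcap_(ij in [set: 'I_m * 'I_n])
    ((fun t => g t ij.1 ij.2) @^-1` [set` `[h * (Q ij.1 ij.2 : nat)%:R - a,
      h * (Q ij.1 ij.2 : nat).+1%:R - a[])).
    apply: fin_bigcap_measurable => // ij _; rewrite -[X in measurable X]setTI.
    exact: mg.
  by apply/seteqP; split=> t At ij; [move=> _; exact: (At ij)|exact: (At ij I)].
move=> t.
have entry i j : (g t - psi (q t)) i j * (g t - psi (q t)) i j <= h ^+ 2.
  rewrite -expr2 !mxE inordK//.
  have /andP[] := truncn_itv (arg_ge0 t i j); rewrite -/(lvl t i j).
  rewrite ler_pdivlMr// ltr_pdivrMr// -[(lvl t i j).+1]addn1 natrD mulrDl mul1r.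
  move=> l1 l2; set x := g t i j - _; have x0 : 0 <= x by rewrite /x; lra.
  by rewrite ler_sqr ?nnegrE ?(ltW h0)// /x; lra.
apply: (@le_trans _ _ (\sum_(i < m) \sum_(j < n) h ^+ 2)).
  by apply: ler_sum => i _; apply: ler_sum => j _; exact: entry.
rewrite sumr_const card_ord sumr_const card_ord -mulrnA -mulr_natl mulnC.
rewrite /h expr_div_n mulrCA -[leRHS]mulr1 ler_wpM2l ?sqr_ge0//.
rewrite ler_pdivrMr ?exprn_gt0 ?ltr_pwDl// mul1r.
by have : 0 <= (m * n)%:R :> R by []; set N := (m * n)%:R; nra.
Qed.

End FiniteQuantization.

(** * Real integrals and conditional expectations against finite-valued weights *)

Section Integrals.
Context d (T : measurableType d) (R : realType) (P : probability T R).
Local Notation L1 f := (P.-integrable setT (EFin \o f)).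

Lemma measurable_frob_inner m n (A B : T -> 'M[R]_(m, n)) :
  (forall i j, measurable_fun setT (fun t => A t i j)) ->
  (forall i j, measurable_fun setT (fun t => B t i j)) ->
  measurable_fun setT (fun t => frob_inner (A t) (B t)).
Proof.
by move=> mA mB; do 2 apply: measurable_sum => ?; exact: measurable_funM.
Qed.

Lemma integrable_le (f g : T -> R) : measurable_fun setT f ->
  (forall t, `|f t| <= g t) -> L1 g -> L1 f.
Proof.
move=> mf fg; apply: le_integrable => //; first exact/measurable_EFinP.
by move=> t _; rewrite /= lee_fin (le_trans (fg t))// ler_norm.
Qed.

Lemma integrable_const (c : R) : L1 (fun=> c).
Proof. exact: finite_measure_integrable_cst. Qed.

Lemma integrableD_real (f g : T -> R) : L1 f -> L1 g -> L1 (fun t => f t + g t).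
Proof. by move=> If Ig; exact: (integrableD measurableT If Ig). Qed.

Lemma integrableZ_real (c : R) (f : T -> R) : L1 f -> L1 (fun t => c * f t).
Proof. by move=> If; exact: (integrableZl measurableT c If). Qed.

Lemma integrable_sum_real (I : Type) (r : seq I) (h : I -> T -> R) :
  (forall i, L1 (h i)) -> L1 (fun t => \sum_(i <- r) h i t).
Proof.
move=> Ih; elim: r => [|i r IH].
  by rewrite (_ : (fun _ => _) = (fun=> 0)) ?funeqE => [|t];
    [exact: integrable_const|rewrite big_nil].
rewrite (_ : (fun _ => _) = (fun t => h i t + \sum_(j <- r) h j t)); last first.
  by apply/funext => t; rewrite big_cons.
exact: integrableD_real.
Qed.

Lemma Rintegral_sum (I : Type) (r : seq I) (h : I -> T -> R) :
  (forall i, L1 (h i)) ->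
  \int[P]_t (\sum_(i <- r) h i t) = \sum_(i <- r) \int[P]_t h i t.
Proof.
move=> Ih; elim: r => [|i r IH].
  by under eq_Rintegral do rewrite big_nil; rewrite big_nil Rintegral_cst// mul0r.
under eq_Rintegral do rewrite big_cons.
by rewrite RintegralD// ?big_cons ?IH//; exact: integrable_sum_real.
Qed.

(* A weight taking finitely many values on F-events is enough here: it avoids
   the general pull-out property of conditional expectations. *)
Lemma cond_exp_simple_weight (F : set (set T)) (Z Y : T -> R) (S : finType)
    (q : T -> S) (w : S -> R) : is_cond_exp P F Z Y ->
  (forall s, F (q @^-1` [set s]) /\ measurable (q @^-1` [set s])) ->
  L1 (fun t => w (q t) * (Y t - Z t)) /\
  \int[P]_t (w (q t) * (Y t - Z t)) = 0.
Proof.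
move=> [_ IZ IY YZ] qF; pose D t := Y t - Z t.
have ID : L1 D.
  rewrite (_ : D = (fun t => Y t + -1 * Z t)); last by apply/funext => t; rewrite /D; ring.
  exact: integrableD_real (integrableZ_real _ _).
have mq s := (qF s).2.
have IDs s : L1 (D \_ (q @^-1` [set s])).
  rewrite -restrict_EFin; apply: (integrable_mkcond _ (mq s)).1.
  exact: (integrableS measurableT (mq s) (@subsetT _ _) ID).
(* The weight is constant on each level set of [q]; there the defining identity of the conditional
   expectation makes the integral vanish. *)
have wD : (fun t => w (q t) * D t) = (fun t => \sum_s w s * (D \_ (q @^-1` [set s])) t).
  apply/funext => t; rewrite (bigD1 (q t))//= big1 => [|s sq]; rewrite patchE.
    by rewrite mem_set// addr0.
  by rewrite memNset ?mulr0// => /= qs; rewrite -qs eqxx in sq.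
have IwDs s : L1 (fun t => w s * (D \_ (q @^-1` [set s])) t) by exact: integrableZ_real.
rewrite -/(D _) wD; split; first exact: integrable_sum_real.
rewrite Rintegral_sum// big1// => s _; rewrite RintegralZl// -Rintegral_mkcond.
rewrite RintegralB//; try exact: (integrableS measurableT (mq s) (@subsetT _ _)).
by rewrite /Rintegral YZ ?subrr ?mulr0//; have [] := qF s.
Qed.

Lemma cond_exp_simple_weight_mx m n (F : set (set T)) (Z Y : T -> 'M[R]_(m, n))
    (S : finType) (q : T -> S) (W : S -> 'M[R]_(m, n)) : is_cond_exp_mx P F Z Y ->
  (forall s, F (q @^-1` [set s]) /\ measurable (q @^-1` [set s])) ->
  L1 (fun t => frob_inner (W (q t)) (Y t - Z t)) /\
  \int[P]_t frob_inner (W (q t)) (Y t - Z t) = 0.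
Proof.
move=> YZ qF.
have ent i j := cond_exp_simple_weight (fun s => W s i j) (YZ i j) qF.
have E : (fun t => frob_inner (W (q t)) (Y t - Z t)) =
    (fun t => \sum_i \sum_j W (q t) i j * (Y t i j - Z t i j)).
  by apply/funext => t; do 2 (apply: eq_bigr => ? _); rewrite !mxE.
rewrite E; split.
  by do 2 apply: integrable_sum_real => ?; exact: (ent _ _).1.
rewrite Rintegral_sum => [|i]; last by apply: integrable_sum_real => j; exact: (ent _ _).1.
rewrite big1// => i _; rewrite Rintegral_sum => [|j]; last exact: (ent _ _).1.
by rewrite big1// => j _; exact: (ent _ _).2.
Qed.

End Integrals.

(** * The expected decrease in one clipped step *)

Section OneStep.
Context d (T : measurableType d) (R : realType) (P : probability T R).
Local Notation L1 f := (P.-integrable setT (EFin \o f)).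

Lemma integrable_measurable (f : T -> R) : L1 f -> measurable_fun setT f.
Proof. by move=> /measurable_int/measurable_EFinP. Qed.

(** Young's inequality for [A] and [e *: B], divided by [e]: the rounding error enters linearly in
    [e]. *)
Lemma frob_inner_small m n (A B : 'M[R]_(m, n)) e : 0 < e ->
  frob_inner A A <= e ^+ 2 ->
  frob_inner A B <= e / 2 * (1 + frob_inner B B).
Proof.
move=> e0 Ae; have := frob_inner_young A (e *: B).
rewrite !frob_innerE => h.
have {}h : e * frob_inner A B <= e * (e / 2 * (1 + frob_inner B B)) by lra.
by rewrite ler_pM2l in h.
Qed.

Lemma ler_scaled_eps (x y c : R) :
  (forall e, 0 < e <= 1 -> x <= y + e * c) -> x <= y.
Proof.
move=> xy; have c'0 : 0 < `|c| + 1 by rewrite ltr_wpDl.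
apply/ler_addgt0Pr => z z0.
pose e := Num.min 1 (z / (`|c| + 1)).
have e0 : 0 < e by rewrite lt_min ltr01 divr_gt0.
have e1 : e <= 1 by rewrite ge_min lexx.
have ez : e * (`|c| + 1) <= z by rewrite -ler_pdivlMr// ge_min lexx orbT.
apply: le_trans (xy e _) _; first by rewrite e0.
have : e * c <= e * `|c| by rewrite ler_wpM2l ?ler_norm// ltW.
by lra.
Qed.

Lemma Rintegral_ae_le (f : T -> R) a : L1 f -> {ae P, forall t, f t <= a} ->
  \int[P]_t f t <= a.
Proof.
move=> If fa; have Ia := integrable_const P a.
have mD : measurable_fun setT (fun t => a - f t).
  by apply: measurable_funB; [exact: measurable_cst|exact: integrable_measurable].
have : 0 <= \int[P]_t (a - f t).
  have -> : \int[P]_t (a - f t) = \int[P]_t `|a - f t|.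
    congr fine; apply: ae_eq_integral => //; first exact/measurable_EFinP.
      by apply/measurable_EFinP; apply: measurableT_comp.
    by apply: filterS fa => t ft _; rewrite ger0_norm// subr_ge0.
  exact: Rintegral_ge0.
rewrite RintegralB// Rintegral_cst//.
have -> : fine (P setT) = 1 by rewrite (probability_setT P).
by rewrite mulr1 subr_ge0.
Qed.

(** Here [c] stands for [L eta^2 / 2] and [g] for the gradient along the iterates. The pointwise
    decrement plus a term of mean zero is bounded by an integrable function with error of order [e],
    and [e] is then sent to 0. *)
Lemma clipped_step_expectation m n (G X H g : T -> 'M[R]_(m, n))
    (tau alpha sigma M eta c : R) :
  0 < tau -> 0 < alpha <= 2 -> 0 <= eta -> 0 <= c <= eta / 2 ->
  (forall t, frob_inner (g t) (g t) <= M) ->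
  is_cond_exp_mx P (sigma_of X) G g ->
  cond_exp_le P (sigma_of X) (fun t => frob (G t - g t) `^ alpha) (sigma `^ alpha) ->
  is_cond_exp_mx P (sigma_of X) (fun t => spectral_clip tau (G t)) H ->
  L1 (fun t => frob_inner (g t - H t) (g t - H t)) ->
  let C t := spectral_clip tau (G t) in
  [/\ L1 (fun t => - eta * frob_inner (g t) (C t) + c * frob_inner (C t) (C t)),
      L1 (fun t => frob_inner (g t) (g t)) &
  \int[P]_t (- eta * frob_inner (g t) (C t) + c * frob_inner (C t) (C t)) <=
    - (eta / 2) * \int[P]_t frob_inner (g t) (g t)
    + eta / 2 * \int[P]_t frob_inner (g t - H t) (g t - H t)
    + c * (2 `^ (2 - alpha) * (minn m n)%:R `^ (1 - alpha / 2)
           * tau `^ (2 - alpha) * sigma `^ alpha)].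
Proof.
move=> tau0 alpha02 eta0 /andP[c0 ceta] gM Gg [Y [[_ IZ IY YZ] Ysigma]] CH IgH C.
set W := 2 `^ (2 - alpha) * _ * _.
have W0 : 0 <= W by rewrite !mulr_ge0 ?powR_ge0.
pose b := (minn m n)%:R * tau ^+ 2.
have Cb t : frob_inner (C t) (C t) <= b := sqr_frob_spectral_clip_le (G t) (ltW tau0).
have mg i j : measurable_fun setT (fun t => g t i j).
  by have [_ _ /integrable_measurable] := Gg i j.
have mC i j : measurable_fun setT (fun t => C t i j).
  by have [_ /integrable_measurable] := CH i j.
have mH i j : measurable_fun setT (fun t => H t i j).
  by have [_ _ /integrable_measurable] := CH i j.
have IC : L1 (fun t => frob_inner (C t) (C t)).
  apply: integrable_le (integrable_const P b); first exact: measurable_frob_inner.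
  by move=> t; rewrite ger0_norm ?frob_inner_ge0.
have Ig : L1 (fun t => frob_inner (g t) (g t)).
  apply: integrable_le (integrable_const P M); first exact: measurable_frob_inner.
  by move=> t; rewrite ger0_norm ?frob_inner_ge0.
have IgC : L1 (fun t => frob_inner (g t) (C t)).
  apply: integrable_le (integrable_const P (M + b)); first exact: measurable_frob_inner.
  move=> t; have := gM t; have := Cb t.
  have := frob_inner_young (g t) (C t); have := frob_inner_young (g t) (- C t).
  have := frob_inner_ge0 (g t); have := frob_inner_ge0 (C t).
  by rewrite !frob_innerE opprK ler_norml => *; apply/andP; split; lra.
(* Square integrability of [H] is inherited from [g - H] and the bounded [g]. *)
have IH : L1 (fun t => frob_inner (H t) (H t)).
  apply: (@integrable_le _ _ _ _ _ (fun t =>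
    2 * (frob_inner (g t - H t) (g t - H t) + frob_inner (g t) (g t)))).
  - exact: measurable_frob_inner.
  - move=> t; rewrite ger0_norm ?frob_inner_ge0//.
    have := frob_innerD_le (g t - H t) (- g t).
    by rewrite addrAC subrr add0r (frob_innerNl (g t)) frob_innerNl !frob_innerNr !opprK.
  - by apply: integrableZ_real; exact: integrableD_real.
set Phi := fun t => - eta * frob_inner (g t) (C t) + c * frob_inner (C t) (C t).
have IPhi : L1 Phi by apply: integrableD_real; exact: integrableZ_real.
split => //.
pose Z t := frob (G t - g t) `^ alpha.
have EZ : \int[P]_t Z t <= sigma `^ alpha.
  have -> : \int[P]_t Z t = \int[P]_t Y t.
    rewrite /Rintegral YZ//; exact: (@measurableT _ (g_sigma_algebraType _)).
  exact: Rintegral_ae_le.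
(* The coefficients of [e] in [PhiD]: rounding [g] against [C], rounding inside the clipping (with
   its cross term), and rounding [g] against [H]. *)
pose k0 := eta / 2 * (1 + b) + c * (1 + 4 * b) + c + eta / 2.
pose kap := eta / 2 * (\int[P]_t frob_inner (H t) (H t)) + k0.
apply: (@ler_scaled_eps _ _ kap) => e /andP[e0 e1].
have gF i j : F_measurable (sigma_of X) (fun t => g t i j) by have [] := Gg i j.
have [S [q [psi [qF gpsi]]]] := entry_quantization gM e0 gF mg.
(* Adding [<w, H - C>], of mean zero, trades [C] for [H] in the linear term up to rounding. With
   [C1] the clipped grid point, it also turns [c |C|^2] into
   [c |C - C1|^2 + c |H|^2 - c |H - C1|^2]. *)
pose w s := - eta *: psi s + (2 * c) *: spectral_clip tau (psi s).
have [ID ED] := cond_exp_simple_weight_mx w CH qF.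
set D := (fun t => _) in ID; rewrite -/C -/(D _) in ED.
pose Q t := - (eta / 2) * frob_inner (g t) (g t) + eta / 2 * frob_inner (g t - H t) (g t - H t)
  + c * (W * Z t) + e * (eta / 2 * frob_inner (H t) (H t) + k0).
have PhiD t : Phi t + D t <= Q t.
  rewrite /Phi /D /Q /w /Z; set A := psi (q t); set x := frob _ `^ alpha.
  set C0 := spectral_clip tau (g t); set C1 := spectral_clip tau A.
  have C0b : frob_inner C0 C0 <= b := sqr_frob_spectral_clip_le (g t) (ltW tau0).
  have p1 := ler_wpM2l eta0 (frob_inner_small (- C t) e0 (gpsi t)).
  have p2 := ler_wpM2l eta0 (frob_inner_small (H t) e0 (gpsi t)).
  have C01 : frob_inner (C0 - C1) (C0 - C1) <= e ^+ 2.
    exact: le_trans (spectral_clip_nonexpansive _ _ (ltW tau0)) (gpsi t).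
  have C00 : frob_inner (C t - C0) (C t - C0) <= W * x.
    exact: sqr_frob_spectral_clipB_le.
  have C0b4 : frob_inner (C t - C0) (C t - C0) <= 4 * b.
    have := frob_innerD_le (C t) (- C0); have := Cb t.
    by rewrite (frob_innerNl C0) frob_innerNr opprK; lra.
  have e2 : e ^+ 2 <= e by rewrite expr2 ler_piMr// ltW.
  (* Split at [C0]: the cross term is of order [e] because [C0 - C1] has norm at most [e], and
     [e^2 <= e] absorbs the last square. *)
  have CC1 : frob_inner (C t - C1) (C t - C1) <= W * x + e * (1 + 4 * b) + e.
    have := frob_inner_small (C t - C0) e0 C01.
    have : e / 2 * (1 + frob_inner (C t - C0) (C t - C0)) <= e / 2 * (1 + 4 * b).
      by rewrite ler_wpM2l ?divr_ge0 ?(ltW e0)//; lra.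
    have -> : C t - C1 = (C t - C0) + (C0 - C1) by rewrite addrA subrK.
    move: C01 C00; move: (C t - C0) (C0 - C1) => u v C01 C00 le_b le_e.
    rewrite frob_innerDl !frob_innerDr (frob_innerC u v); lra.
  have p3 := ler_wpM2l c0 CC1.
  have p4 := mulr_ge0 c0 (frob_inner_ge0 (H t - C1)).
  have p5 : c * frob_inner (H t) (H t) <= eta / 2 * frob_inner (H t) (H t).
    by rewrite ler_wpM2r ?frob_inner_ge0.
  have p6 : eta * (e / 2 * (1 + frob_inner (- C t) (- C t))) <= eta * (e / 2 * (1 + b)).
    rewrite ler_wpM2l// ler_wpM2l ?divr_ge0 ?(ltW e0)//.
    by rewrite frob_innerNl frob_innerNr opprK lerD2l.
  move: p1 p2 p3 p4 p5 p6; rewrite /k0 -/(C t) !frob_innerE.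
  rewrite (frob_innerC (H t) (g t)) (frob_innerC (H t) C1) (frob_innerC (C t) C1).
  rewrite -/A -/C1; clear -e0; lra.
have IZ' : L1 (fun t => c * (W * Z t)) by do 2 apply: integrableZ_real.
have IH' : L1 (fun t => eta / 2 * frob_inner (H t) (H t)) by exact: integrableZ_real.
have IHk : L1 (fun t => e * (eta / 2 * frob_inner (H t) (H t) + k0)).
  by apply: integrableZ_real; apply: integrableD_real => //; exact: integrable_const.
have Ig' : L1 (fun t => - (eta / 2) * frob_inner (g t) (g t)) by exact: integrableZ_real.
have IgH' : L1 (fun t => eta / 2 * frob_inner (g t - H t) (g t - H t)).
  exact: integrableZ_real.
have Igg : L1 (fun t => - (eta / 2) * frob_inner (g t) (g t)
    + eta / 2 * frob_inner (g t - H t) (g t - H t)) by exact: integrableD_real.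
have IggZ : L1 (fun t => - (eta / 2) * frob_inner (g t) (g t)
    + eta / 2 * frob_inner (g t - H t) (g t - H t) + c * (W * Z t)).
  exact: integrableD_real.
have EQ : \int[P]_t Q t =
  - (eta / 2) * \int[P]_t frob_inner (g t) (g t)
  + eta / 2 * \int[P]_t frob_inner (g t - H t) (g t - H t)
  + c * (W * \int[P]_t Z t) + e * kap.
  rewrite /Q RintegralD// RintegralD// RintegralD//; congr (_ + _ + _ + _).
  - by rewrite RintegralZl.
  - by rewrite RintegralZl.
  - by rewrite RintegralZl// ?RintegralZl//; exact: integrableZ_real.
  have IHk0 : L1 (fun=> k0) := integrable_const P k0.
  rewrite RintegralZl//; last exact: integrableD_real.
  rewrite RintegralD// RintegralZl// Rintegral_cst//.
  have -> : fine (P setT) = 1 by rewrite (probability_setT P).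
  by rewrite mulr1.
have : \int[P]_t (Phi t + D t) <= \int[P]_t Q t.
  by apply: le_Rintegral => //; exact: integrableD_real.
rewrite RintegralD// ED addr0 EQ => /le_trans; apply.
by rewrite lerD2r lerD2l !ler_wpM2l.
Qed.

End OneStep.

(** * Descent *)

Section Descent.
Context {R : realType} (m n : nat).
Variables (f : 'M[R]_(m, n) -> R) (gradf : 'M[R]_(m, n) -> 'M[R]_(m, n)) (L : R).
Hypothesis L0 : 0 < L.
Hypothesis smooth : forall A B, f A <= f B + frob_inner (gradf B) (A - B)
  + L / 2 * frob (A - B) ^+ 2.
Hypothesis f_lb : has_lbound (range f).

Lemma inf_range_le Y : inf (range f) <= f Y.
Proof. by apply: ge_inf => //; exists Y. Qed.

(** A gradient step of size [1 / L] from [Y] lowers [f] by at least [|gradf Y|^2 / (2 L)] and cannot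
    go below the infimum. *)
Lemma sqr_frob_grad_le Y :
  frob_inner (gradf Y) (gradf Y) <= 2 * L * (f Y - inf (range f)).
Proof.
have := smooth (Y - L^-1 *: gradf Y) Y; rewrite sqr_frob.
have -> : Y - L^-1 *: gradf Y - Y = - (L^-1 *: gradf Y) by rewrite addrAC subrr add0r.
have := inf_range_le (Y - L^-1 *: gradf Y).
rewrite !frob_innerE opprK; set a := inf _; set N := frob_inner _ _ => h1 h2.
have {h1 h2} : a <= f Y - L^-1 * N / 2.
  apply: le_trans h1 _; apply: le_trans h2 _; rewrite le_eqVlt; apply/orP; left.
  by apply/eqP; field; rewrite gt_eqF.
move=> h; have -> : N = L * (L^-1 * N) by rewrite mulrA divff ?mul1r// gt_eqF.
move: h; set u := L^-1 * N => h; rewrite [2 * L]mulrC -mulrA ler_pM2l//; lra.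
Qed.

(** Smoothness at [X0] bounds [f] from above on the ball, and [sqr_frob_grad_le] turns this into a
    gradient bound. *)
Lemma grad_bounded_near X0 (D : R) : exists M, forall Y,
  frob_inner (Y - X0) (Y - X0) <= D -> frob_inner (gradf Y) (gradf Y) <= M.
Proof.
exists (2 * L * (f X0 + (frob_inner (gradf X0) (gradf X0) + D) + L / 2 * D
  - inf (range f))) => Y YD.
apply: le_trans (sqr_frob_grad_le Y) _; rewrite ler_pM2l ?mulr_gt0//.
rewrite lerD2r; apply: le_trans (smooth Y X0) _; rewrite sqr_frob.
have h : L / 2 * frob_inner (Y - X0) (Y - X0) <= L / 2 * D.
  by rewrite ler_pM2l// divr_gt0.
have := frob_inner_young (gradf X0) (Y - X0).
have := frob_inner_ge0 (gradf X0); have := frob_inner_ge0 (Y - X0).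
by lra.
Qed.

End Descent.

(** * Deterministic estimates along the iterates *)

Section ClippedIteration.
Context {R : realType} (T : Type) (m n : nat).
Variables (f : 'M[R]_(m, n) -> R) (gradf : 'M[R]_(m, n) -> 'M[R]_(m, n)).
Variables (L tau eta : R) (K : nat) (X0 : 'M[R]_(m, n)) (X G : nat -> T -> 'M[R]_(m, n)).
Hypothesis tau0 : 0 <= tau.
Hypothesis smooth : forall A B, f A <= f B + frob_inner (gradf B) (A - B)
  + L / 2 * frob (A - B) ^+ 2.
Hypothesis Xinit : forall t, X 0%N t = X0.
Hypothesis Xstep : forall k, (k < K)%N -> forall t,
  X k.+1 t = X k t - eta *: spectral_clip tau (G k t).

(** Clipped steps have bounded length, so [D] is uniform in [t]; this is what makes the gradients
    along the iteration bounded. *)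
Lemma iterates_bounded k : (k <= K)%N ->
  exists D, forall t, frob_inner (X k t - X0) (X k t - X0) <= D.
Proof.
elim: k => [_|k IH kK].
  by exists 0 => t; rewrite Xinit subrr frob_inner0l.
have [D XD] := IH (ltnW kK).
exists (2 * (D + eta ^+ 2 * ((minn m n)%:R * tau ^+ 2))) => t.
rewrite Xstep// addrAC; set C := spectral_clip _ _.
apply: le_trans (frob_innerD_le _ _) _; rewrite ler_pM2l// lerD//.
rewrite frob_innerNl frob_innerNr opprK frob_innerZl frob_innerZr mulrA -expr2.
by rewrite ler_wpM2l ?sqr_ge0// sqr_frob_spectral_clip_le.
Qed.

(** Telescoping is done pointwise: afterwards only constants and the increments have to be
    integrated, not [f (X k t)] itself. *)
Lemma descent_telescope k t : (k <= K)%N ->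
  f (X k t) <= f X0 + \sum_(i < k)
    (- eta * frob_inner (gradf (X i t)) (spectral_clip tau (G i t))
     + L / 2 * eta ^+ 2 * frob_inner (spectral_clip tau (G i t)) (spectral_clip tau (G i t))).
Proof.
elim: k => [_|k IH kK]; first by rewrite big_ord0 addr0 Xinit.
rewrite big_ord_recr /= addrA; have /IH := ltnW kK.
have := smooth (X k.+1 t) (X k t); rewrite Xstep// sqr_frob.
set C := spectral_clip _ _.
have -> : X k t - eta *: C - X k t = - (eta *: C) by rewrite addrAC subrr add0r.
rewrite !frob_innerNr frob_innerNl opprK !frob_innerZr frob_innerZl.
set a := frob_inner _ _; set b := frob_inner _ _; set s := \sum_(_ < _) _; lra.
Qed.

End ClippedIteration.

(** Otherwise all terms exceed [S], and summing the strict inequalities over a nonempty range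
    contradicts the hypothesis. *)
Lemma min_le_average (R : realType) (K : nat) (a : nat -> R) (S : R) : (0 < K)%N ->
  \sum_(k < K) a k <= K%:R * S -> exists2 k : 'I_K, true & a k <= S.
Proof.
move=> K0 aS; have [/existsP[k ak]|] := boolP [exists k : 'I_K, a k <= S]; first by exists k.
rewrite negb_exists => /forallP aS'; move: aS; rewrite leNgt => /negP[].
have -> : K%:R * S = \sum_(k < K) S by rewrite sumr_const card_ord mulr_natl.
apply: ltr_sum; first by apply/hasP; exists (Ordinal K0); rewrite ?mem_index_enum.
by move=> k _; rewrite ltNge.
Qed.

(** * Summation of the step bounds and the final estimate *)

Unset Implicit Arguments.

Theorem theorem1 (d : measure_display) (T : measurableType d) (R : realType)
  (P : probability T R) (m n : nat)
  (f : 'M[R]_(m, n) -> R) (gradf : 'M[R]_(m, n) -> 'M[R]_(m, n))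
  (L tau alpha sigma : R) (K : nat) (X0 : 'M[R]_(m, n))
  (G X H : nat -> T -> 'M[R]_(m, n)) :
  0 < L ->
  (* gradf is the (Frechet) gradient of f w.r.t. the Frobenius inner product *)
  (forall Y, differentiable f Y /\
     (forall V, 'd f Y V = frob_inner (gradf Y) V)) ->
  (* L-smoothness *)
  (forall A B, f A <= f B + frob_inner (gradf B) (A - B)
                       + L / 2 * frob (A - B) ^+ 2) ->
  (* f_* = inf f > -oo *)
  has_lbound (range f) ->
  0 < tau -> (1 <= K)%N -> 1 < alpha <= 2 -> 0 < sigma ->
  (forall k, (k < K)%N -> forall i j, measurable_fun setT (fun t => G k t i j)) ->
  (forall t, X 0%N t = X0) ->
  (forall k, (k < K)%N -> forall t,
     X k.+1 t = X k t - (1 / (4 * L * Num.sqrt K%:R)) *: spectral_clip tau (G k t)) ->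
  (* E[G_k | X_k] = grad f (X_k) *)
  (forall k, (k < K)%N ->
     is_cond_exp_mx P (sigma_of (X k)) (G k) (fun t => gradf (X k t))) ->
  (* E[ ||G_k - grad f(X_k)||_F^alpha | X_k ] <= sigma^alpha *)
  (forall k, (k < K)%N ->
     cond_exp_le P (sigma_of (X k))
       (fun t => powR (frob (G k t - gradf (X k t))) alpha) (powR sigma alpha)) ->
  (* H k is (a version of) E[C_tau(G_k) | X_k] *)
  (forall k, (k < K)%N ->
     is_cond_exp_mx P (sigma_of (X k)) (fun t => spectral_clip tau (G k t)) (H k)) ->
  (\big[Order.min/+oo]_(k < K) \int[P]_t ((frob (gradf (X k t)) ^+ 2)%:E)
   <= (16 * L * (f X0 - inf (range f)) / Num.sqrt K%:R
       + powR 2 (4 - alpha) * powR (minn m n)%:R (1 - alpha / 2)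
         * powR tau (2 - alpha) * powR sigma alpha / (8 * Num.sqrt K%:R))%:E
      + (2 / K%:R)%:E
        * \sum_(k < K) \int[P]_t ((frob (gradf (X k t) - H k t) ^+ 2)%:E))%E.
Proof.
move=> L0 _ smooth f_lb tau0 K0 alpha12 sigma0 _ Xinit Xstep Gg Gsigma CH.
set W := 2 `^ (4 - alpha) * _ * _ * _.
set s := Num.sqrt K%:R; set fs := inf (range f).
pose Dl k := (\int[P]_t (frob (gradf (X k t) - H k t) ^+ 2)%:E)%E.
have Dl0 k : (0 <= Dl k)%E by apply: integral_ge0 => t _; rewrite lee_fin sqr_ge0.
have K0' : 0 < K%:R :> R by rewrite ltr0n.
have s0 : 0 < s by rewrite sqrtr_gt0.
have sK : s * s = K%:R by rewrite -expr2 sqr_sqrtr// ltW.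
have s1 : 1 <= s by rewrite -(@ler_pXn2r _ 2%N) ?nnegrE ?(ltW s0)// expr1n expr2 sK ler1n.
have Lneq : L != 0 by rewrite gt_eqF.
have sneq : s != 0 by rewrite gt_eqF.
(* If some [Dl k] is infinite, the right-hand side is [+oo]; otherwise all quantities are real. *)
have [Dfin|] := boolP [forall k : 'I_K, Dl k \is a fin_num]; last first.
  rewrite negb_forall => /existsP[k Dk].
  have -> : (\sum_(k < K) Dl k)%E = +oo%E.
    apply/eqP; rewrite eq_le leey/=.
    have <- : Dl k = +oo%E.
      by move: Dk; rewrite ge0_fin_numE ?Dl0// -leNgt leye_eq => /eqP.
    by rewrite (bigD1 k)//= leeDl// sume_ge0.
  by rewrite gt0_muley ?lte_fin ?divr_gt0// addey// leey.
pose eta := 1 / (4 * L * s); pose c := L / 2 * eta ^+ 2.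
have eta0 : 0 < eta by rewrite divr_gt0 ?mulr_gt0.
have c_bounds : 0 <= c <= eta / 2.
  rewrite /c mulr_ge0 ?sqr_ge0 ?divr_ge0 ?(ltW L0)//=.
  (* [L * eta] equals the inverse of [4 * s], which is at most 1 because [s >= 1]. *)
  have -> : L / 2 * eta ^+ 2 = eta / 2 * (4 * s)^-1.
    by rewrite /eta; field; rewrite Lneq sneq.
  have eta2 : 0 <= eta / 2 by apply: divr_ge0 => //; exact: ltW.
  rewrite -[leRHS]mulr1 ler_wpM2l//.
  by rewrite invf_le1 ?mulr_gt0//; lra.
have alpha02 : 0 < alpha <= 2.
  by have /andP[a1 ->] := alpha12; rewrite (lt_trans _ a1).
pose C k t := spectral_clip tau (G k t).
pose V := 2 `^ (2 - alpha) * (minn m n)%:R `^ (1 - alpha / 2)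
           * tau `^ (2 - alpha) * sigma `^ alpha.
(* The exponent splits as [4 - alpha = 2 + (2 - alpha)]. *)
have WV : W = 4 * V.
  have -> : W = 2 `^ 2 * V.
    rewrite /W /V !mulrA -powRD; last by rewrite pnatr_eq0 implybT.
    by congr (2 `^ _ * _ * _ * _); ring.
  by rewrite powR_mulrn// expr2; ring.
pose Phi k t := - eta * frob_inner (gradf (X k t)) (C k t)
                + c * frob_inner (C k t) (C k t).
have step k : (k < K)%N -> [/\ P.-integrable setT (EFin \o Phi k),
    P.-integrable setT (EFin \o (fun t => frob_inner (gradf (X k t)) (gradf (X k t)))) &
  \int[P]_t Phi k t <=
    - (eta / 2) * \int[P]_t frob_inner (gradf (X k t)) (gradf (X k t))
    + eta / 2 * \int[P]_t frob_inner (gradf (X k t) - H k t) (gradf (X k t) - H k t)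
    + c * V].
  move=> kK.
  have [D XD] := iterates_bounded (ltW tau0) Xinit Xstep (ltnW kK).
  have [M gM] := grad_bounded_near L0 smooth f_lb X0 D.
  apply: (@clipped_step_expectation _ _ _ P _ _ (G k) (X k) (H k)
    (fun t => gradf (X k t)) tau alpha sigma M eta c) => //.
  - exact: ltW.
  - by move=> t; apply: gM.
  - exact: Gg.
  - exact: Gsigma.
  - exact: CH.
  have mgH i j : measurable_fun setT (fun t => (gradf (X k t) - H k t) i j).
    rewrite (_ : (fun _ => _) = (fun t => gradf (X k t) i j - H k t i j)).
      apply: measurable_funB; apply: (@integrable_measurable _ _ _ P).
        by have [] := Gg k kK i j.
      by have [] := CH k kK i j.
    by apply/funext => t; rewrite !mxE.
  have mD := measurable_frob_inner mgH mgH.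
  (* Finiteness of [Dl k] is exactly the integrability of the squared bias. *)
  apply/integrableP; split; first exact/measurable_EFinP.
  have := forallP Dfin (Ordinal kK); rewrite /Dl /= -integral_fin_num_abs//.
    by under eq_integral do rewrite sqr_frob.
  by under eq_fun do rewrite sqr_frob.
pose a k := \int[P]_t frob_inner (gradf (X k t)) (gradf (X k t)).
pose b k := \int[P]_t frob_inner (gradf (X k t) - H k t) (gradf (X k t) - H k t).
have aE k : (k < K)%N -> (\int[P]_t (frob (gradf (X k t)) ^+ 2)%:E)%E = (a k)%:E.
  move=> kK; rewrite fineK; last by apply: integrable_fin_num => //; have [] := step k kK.
  by apply: eq_integral => t _; rewrite sqr_frob.
have bE k : (k < K)%N -> Dl k = (b k)%:E.
  move=> kK; have /fineK <- := forallP Dfin (Ordinal kK); congr (fine _)%:E.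
  by apply: eq_integral => t _; rewrite sqr_frob.
have IPhi k : (k < K)%N -> P.-integrable setT (EFin \o Phi k) by move=> /step[].
have fs_sum : fs - f X0 <= \sum_(k < K) \int[P]_t Phi k t.
  rewrite -Rintegral_sum => [|k]; last exact: IPhi.
  have -> : fs - f X0 = \int[P]_t (fs - f X0).
    rewrite Rintegral_cst//.
    have -> : fine (P setT) = 1 by rewrite (probability_setT P).
    by rewrite mulr1.
  apply: le_Rintegral => //; first exact: integrable_const.
    by apply: integrable_sum_real => k; exact: IPhi.
  move=> t _; rewrite lerBlDl.
  apply: le_trans (descent_telescope smooth Xinit Xstep t (leqnn K)).
  exact: inf_range_le.
have sum_le : fs - f X0 <=
    - (eta / 2) * (\sum_(k < K) a k) + eta / 2 * (\sum_(k < K) b k) + K%:R * (c * V).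
  apply: le_trans fs_sum _; rewrite !mulr_sumr -big_split /=.
  have -> : K%:R * (c * V) = \sum_(k < K) c * V by rewrite sumr_const card_ord mulr_natl.
  by rewrite -big_split /=; apply: ler_sum => k _; have [] := step k (ltn_ord k).
pose B := 16 * L * (f X0 - fs) / s + W / (8 * s) + 2 / K%:R * \sum_(k < K) b k.
have [k _ ak] : exists2 k : 'I_K, true & a k <= B.
  apply: min_le_average => //.
  move: sum_le; rewrite /B WV; set Sa := \sum_(_ < _) a _; set Sb := \sum_(_ < _) b _.
  have V0 : 0 <= V by rewrite !mulr_ge0 ?powR_ge0.
  have f0 : 0 <= f X0 - fs by rewrite subr_ge0 inf_range_le.
  have Sb0 : 0 <= Sb.
    by apply: sumr_ge0 => i _; rewrite Rintegral_ge0// => t _; exact: frob_inner_ge0.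
  have Ls0 : 0 < 8 * L * s by rewrite !mulr_gt0.
  (* Multiply by [2 / eta = 8 L s] to give [Sa] coefficient one. The target [K * B] is twice the
     resulting bound, so nonnegativity of its three terms finishes. *)
  rewrite -(ler_pM2l Ls0).
  have -> : 8 * L * s * (- (eta / 2) * Sa + eta / 2 * Sb + K%:R * (c * V)) =
      - Sa + Sb + s * V / 4.
    by rewrite /c /eta -sK; field; rewrite Lneq sneq.
  have -> : K%:R * (16 * L * (f X0 - fs) / s + 4 * V / (8 * s) + 2 / K%:R * Sb) =
      2 * (8 * L * s * (f X0 - fs)) + 2 * (s * V / 4) + 2 * Sb.
    by rewrite -sK; field; rewrite sneq.
  have : 0 <= 8 * L * s * (f X0 - fs) by rewrite mulr_ge0// ltW.
  have : 0 <= s * V / 4 by rewrite divr_ge0// mulr_ge0// ltW.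
  lra.
have -> : (\sum_(k < K) Dl k)%E = (\sum_(k < K) b k)%:E.
  by rewrite -sumEFin; apply: eq_bigr => i _; exact: bE.
rewrite -EFinM -EFinD -/B; apply: (@le_trans _ _ (a k)%:E); last by rewrite lee_fin.
by rewrite -aE//; exact: (@bigmin_le_cond _ _ 'I_K).
Qed.
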